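(* Let $\Delta$ be a $(d-1)$-dimensional simplicial complex with $h_i(\Delta)\ge 0$ and $h_i(\Delta)=h_{d-i}(\Delta)$ for $0\le i\le d$. Then the Charney–Davis conjecture holds for the interval subdivision $\mathrm{Int}(\Delta)$, that is, $$(-1)^{\lfloor d/2\rfloor}\,h(\mathrm{Int}(\Delta),-1)\ge 0.$$
   Context: Simplicial complexes are finite abstract simplicial complexes on a ground set $[n]$, containing the empty face $\emptyset$ (of dimension $-1$). For a $(d-1)$-dimensional $\Delta$, $f_i(\Delta)$ is the number of $i$-dimensional faces ($f_{-1}(\Delta)=1$), $h_k(\Delta)=\sum_{i=0}^{k}(-1)^{k-i}\binom{d-i}{k-i}f_{i-1}(\Delta)$ for $0\le k\le d$, and $h(\Delta,x)=\sum_{i=0}^d h_i(\Delta)x^i$. Interval subdivision: let $I(\Delta\setminus\{\emptyset\})=\{[A,B] : \emptyset\ne A\subseteq B\in\Delta\}$, partially ordered by $[A,B]\subseteq[A',B']$ iff $A'\subseteq A\subseteq B\subseteq B'$. $\mathrm{Int}(\Delta)$ is the simplicial complex on the ground set $I(\Delta\setminus\{\emptyset\})$ whose faces are all chains of this poset; it is again $(d-1)$-dimensional. A $(d-1)$-dimensional simplicial complex $\Gamma$ with a non-negative reciprocal $h$-vector (i.e. $h_i(\Gamma)\ge0$ and $h_i(\Gamma)=h_{d-i}(\Gamma)$ for all $i$) is said to satisfy the Charney–Davis conjecture if $(-1)^{\lfloor d/2\rfloor}h(\Gamma,-1)\ge0$. *)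

(* Defs.v *)
From HB Require Import structures.
From mathcomp Require Import all_boot all_order all_algebra.
Set Implicit Arguments.
Unset Strict Implicit.
Unset Printing Implicit Defensive.

Import GRing.Theory.
Local Open Scope ring_scope.

(* The ground set is the whole type T; its elements need not be vertices. *)
Record simplicial_complex (T : finType) := SimplicialComplex {
  faces :> {set {set T}};
  faces_set0 : set0 \in faces;
  faces_down : forall A B : {set T}, A \subset B -> B \in faces -> A \in faces
}.

Section HVector.
Variables (T : finType) (K : simplicial_complex T).

(* A face F has dimension #|F| - 1, so this is the dimension of K plus one,
   i.e. the d for which K is (d-1)-dimensional. *)
Definition sc_rank : nat := (\max_(F in faces K) #|F|)%N.

(* Indexed by cardinality: fnum i is f_{i-1}. *)
Definition fnum (i : nat) : nat := #|[set F in faces K | #|F| == i]|.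

Definition hnum (k : nat) : int :=
  \sum_(i < k.+1)
     (-1) ^+ (k - i) * 'C(sc_rank - i, k - i)%:R * (fnum i)%:R.

Definition hpoly : {poly int} := \poly_(i < sc_rank.+1) hnum i.

End HVector.

Section IntervalSubdivision.
Variables (T : finType) (K : simplicial_complex T).

Definition is_interval (p : {set T} * {set T}) : bool :=
  [&& p.1 != set0, p.1 \subset p.2 & p.2 \in faces K].

(* The pair (A, B) stands for the interval [A, B]. *)
Definition interval : finType := {p : {set T} * {set T} | is_interval p}.

Definition interval_le (I J : interval) : bool :=
  [&& (val J).1 \subset (val I).1,
      (val I).1 \subset (val I).2 &
      (val I).2 \subset (val J).2].

Definition is_chain (C : {set interval}) : bool :=
  [forall I in C, forall J in C, interval_le I J || interval_le J I].

Definition interval_chains : {set {set interval}} := [set C | is_chain C].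

Fact interval_chains_set0 : set0 \in interval_chains.
Proof. by rewrite inE; apply/forall_inP => I; rewrite inE. Qed.

Fact interval_chains_down (A B : {set interval}) :
  A \subset B -> B \in interval_chains -> A \in interval_chains.
Proof.
move=> /subsetP sAB; rewrite !inE => /forall_inP chB.
apply/forall_inP => I /sAB IB; apply/forall_inP => J /sAB JB.
by have /forall_inP := chB I IB; apply.
Qed.

Definition interval_subdivision : simplicial_complex interval :=
  SimplicialComplex interval_chains_set0 interval_chains_down.

End IntervalSubdivision.

(* Main.v *)
Require Import Defs.
From HB Require Import structures.
From mathcomp Require Import all_boot all_order all_algebra ring lra.
Set Implicit Arguments.
Unset Strict Implicit.
Unset Printing Implicit Defensive.
Import Order.TTheory GRing.Theory Num.Theory.
Local Open Scope ring_scope.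

(** Evaluating at -1 the identity that expresses an h-polynomial through the
    faces gives h(K, -1) = 2^r * \sum_F (-1/2)^|F|, with r the rank of K
    (hpoly_at_N1); so the sign of h(Int(Delta), -1) is that of the sum of
    (-1/2)^|C| over all chains C of intervals.

    In that sum, group the chains by their largest interval [A, B].  The
    intervals contained in [A, B] form the face poset of a cube of dimension
    m = |B \ A|, and the resulting recursion identifies the total weight of the
    group as -E_m / 2, where E_m is the m-th derivative of sech at 0
    (interval_weight_rec).  Let M be the linear functional
    p |-> p(d/dz) sech z at z = 0, so that M(X^m) = E_m.  Since
    (e^z + e^-z) sech z = 2, it satisfies M(p(X+1)) + M(p(X-1)) = 2 p(0)
    (sech_fun_shifts), and the sum over all chains becomes
      (M(P(X-1)) + M(P)) / 2,  where  P = \sum_(B in Delta) X^|B|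
    (sum_interval_chains).  The definition of the h-vector amounts to
    P = \sum_k h_k X^k (X+1)^(d-k).  With the reflection X |-> -X, which
    preserves M, and with h_k = h_(d-k), the sum over all chains is
      (1 + (-1)^d) / 2 * \sum_k h_k M(X^k (X-1)^(d-k)).
    It vanishes for odd d.  For even d what remains is
      (-1)^(n/2) M(X^j (X-1)^k) >= 0  for n = j + k even
    (sech_fun_sign), which in terms of generating functions says that
    cos v / cos(u+v) has nonnegative Taylor coefficients in total even degree.

    To prove this, a function sech z * p(-tanh z) is represented by the
    polynomial p, and sech^2 z * q(-tanh z) by q; differentiation in z becomes
    the operators sech_deriv and sech2_deriv.  As (e^z sech z)' = sech^2 z, and
    similarly for -z, the functions (d/dz +- 1)^(k+1) sech z have the
    representatives (X +- 1) * V^k 1 with V = sech2_deriv (act_shift_exp).  In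
    total even degree only the summand X * V^k 1 counts, and the operators
    involved, namely multiplication by X and the two derivations, all preserve
    an alternating sign pattern of the coefficients (tanh_sign), hence the sign
    of the value at 0. *)

(** * Polynomials in an endomorphism *)

Section PolyAct.
Variables (R : comNzRingType) (U : lmodType R) (f : {linear U -> U}).

Definition poly_act (u : U) (p : {poly R}) : U :=
  \sum_(i < size p) p`_i *: iter i f u.

Lemma poly_act_wide n (p : {poly R}) u :
  (size p <= n)%N -> poly_act u p = \sum_(i < n) p`_i *: iter i f u.
Proof.
move=> sz; rewrite /poly_act (big_ord_widen n (fun i => p`_i *: iter i f u)) //.
rewrite [RHS](bigID (fun i : 'I_n => (i < size p)%N)) /= [X in _ + X]big1 ?addr0 //.
by move=> i; rewrite -leqNgt => /(nth_default 0) ->; rewrite scale0r.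
Qed.

Lemma poly_act_linear u : linear (poly_act u).
Proof.
move=> a p q; set n := maxn (size p) (size q).
have sn : (size (a *: p + q)%R <= n)%N.
  rewrite (leq_trans (size_polyD _ _)) // geq_max leq_maxr andbT.
  by rewrite (leq_trans (size_scale_leq _ _)) ?leq_maxl.
rewrite !(@poly_act_wide n) ?leq_maxl ?leq_maxr // scaler_sumr -big_split /=.
by apply: eq_bigr => i _; rewrite coefD coefZ scalerDl scalerA.
Qed.

HB.instance Definition _ u :=
  GRing.isLinear.Build R {poly R} U _ (poly_act u) (poly_act_linear u).

Lemma poly_actC (c : R) u : poly_act u c%:P = c *: u.
Proof. by rewrite (@poly_act_wide 1) ?size_polyC_leq1 // big_ord1 coefC. Qed.

Lemma poly_act1 u : poly_act u 1 = u.
Proof. by rewrite poly_actC scale1r. Qed.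

Lemma poly_act_mulX (p : {poly R}) u : poly_act u (p * 'X) = poly_act (f u) p.
Proof.
rewrite (@poly_act_wide (size p).+1); last first.
  by rewrite (leq_trans (size_polyMleq _ _)) // size_polyX addn2.
rewrite big_ord_recl coefMX scale0r add0r.
by apply: eq_bigr => i _; rewrite coefMX /= -iterSr.
Qed.

Lemma poly_act_comm (p : {poly R}) u : poly_act (f u) p = f (poly_act u p).
Proof.
rewrite linear_sum; apply: eq_bigr => i _.
by rewrite linearZ /= -iterSr.
Qed.

Lemma poly_actM (p q : {poly R}) u : poly_act u (p * q) = poly_act (poly_act u q) p.
Proof.
elim/poly_ind: p u => [|p c IH] u.
  by rewrite mul0r !linear0.
rewrite mulrDl mulrAC !linearD /= !poly_act_mulX IH.
by rewrite poly_act_comm mul_polyC linearZ /= poly_actC.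
Qed.

Lemma poly_actXn n u : poly_act u 'X^n = iter n f u.
Proof.
elim: n u => [|n IH] u; first by rewrite expr0 poly_act1.
by rewrite exprSr poly_act_mulX IH -iterSr.
Qed.

End PolyAct.

(** * Derivatives of the hyperbolic secant *)

(** Differentiation in z, when p stands for sech z * p(-tanh z): use
    (-tanh)' = tanh^2 - 1 and sech' = -tanh * sech. *)
Definition sech_deriv (p : {poly rat}) : {poly rat} :=
  'X * p + ('X^2 - 1) * p^`().

(** Differentiation in z, when q stands for sech^2 z * q(-tanh z). *)
Definition sech2_deriv (q : {poly rat}) : {poly rat} :=
  'X *+ 2 * q + ('X^2 - 1) * q^`().

Lemma sech_deriv_linear : linear sech_deriv.
Proof. by move=> a p q; rewrite /sech_deriv linearP /= -!mul_polyC; ring. Qed.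

HB.instance Definition _ :=
  GRing.isLinear.Build rat {poly rat} {poly rat} _ sech_deriv sech_deriv_linear.

Lemma sech2_deriv_linear : linear sech2_deriv.
Proof. by move=> a p q; rewrite /sech2_deriv linearP /= -!mul_polyC; ring. Qed.

HB.instance Definition _ :=
  GRing.isLinear.Build rat {poly rat} {poly rat} _ sech2_deriv sech2_deriv_linear.

(** For e = 1, say, sech z * (X + 1) is e^-z sech^2 z at X = -tanh z, and
    d/dz + 1 is the conjugate of d/dz by multiplication by e^-z. *)
Lemma sech_deriv_shift (e : rat) (q : {poly rat}) : e ^+ 2 = 1 ->
  sech_deriv (('X + e%:P) * q) + e *: (('X + e%:P) * q) =
  ('X + e%:P) * sech2_deriv q.
Proof.
move=> e1; have {}e1 : e%:P ^+ 2 = 1 :> {poly rat} by rewrite -polyC_exp e1.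
rewrite /sech_deriv /sech2_deriv derivM derivD derivX derivC addr0 -mul_polyC.
move: e%:P e1 => E E1; ring: E1.
Qed.

(** This computes (d/dz + e)^(k+1) sech z, starting from
    (e^z sech z)' = sech^2 z for e = 1 and from its mirror image for e = -1. *)
Lemma act_shift_exp (e : rat) k : e ^+ 2 = 1 ->
  poly_act sech_deriv 1 (('X + e%:P) ^+ k.+1) = ('X + e%:P) * iter k sech2_deriv 1.
Proof.
move=> e1.
have actE p : poly_act sech_deriv p ('X + e%:P) = sech_deriv p + e *: p.
  by rewrite linearD /= -['X]mul1r poly_act_mulX poly_act1 poly_actC.
elim: k => [|k IH].
  by rewrite expr1 actE mulr1 /sech_deriv derivC -mul_polyC; ring.
by rewrite exprS poly_actM IH actE sech_deriv_shift.
Qed.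

Definition sech_num (n : nat) : rat := (iter n sech_deriv 1).[0].

(** The value at z = 0 of p(d/dz) sech z. *)
Definition sech_fun (p : {poly rat}) : rat := (poly_act sech_deriv 1 p).[0].

Lemma sech_fun_linear : linear_for *%R sech_fun.
Proof.
by move=> a p q; rewrite /sech_fun linearP /= hornerD hornerZ.
Qed.

HB.instance Definition _ :=
  GRing.isLinear.Build rat {poly rat} rat _ sech_fun sech_fun_linear.

Lemma sech_funXn n : sech_fun 'X^n = sech_num n.
Proof. by rewrite /sech_fun poly_actXn. Qed.

(** This is (e^z + e^-z) sech z = 2.  For the representatives it reads
    (X + 1) V^k 1 + (X - 1) V^k 1 = 2 X V^k 1, which vanishes at 0. *)
Lemma sech_fun_shifts (p : {poly rat}) :
  sech_fun (p \Po ('X + 1)) + sech_fun (p \Po ('X - 1)) = p.[0] *+ 2.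
Proof.
have mono n : sech_fun (('X + 1) ^+ n) + sech_fun (('X - 1) ^+ n) = (n == 0)%:R *+ 2.
  case: n => [|n]; first by rewrite !expr0 /sech_fun poly_act1 hornerE.
  have e1 : (1 : rat) ^+ 2 = 1 by [].
  have e2 : (-1 : rat) ^+ 2 = 1 by [].
  rewrite /sech_fun; have := act_shift_exp n e1; have := act_shift_exp n e2.
  rewrite polyCN polyC1 => -> ->; rewrite -hornerD -mulrDl addrACA subrr addr0.
  by rewrite !hornerE ?mul0r ?mul0rn.
rewrite !comp_polyE !linear_sum -big_split horner_coef0 /=.
under eq_bigr do rewrite !linearZ /= -mulrDr mono.
case: (posnP (size p)) => [s0|s0].
  have /eqP := s0; rewrite size_poly_eq0 => /eqP->.
  by rewrite size_poly0 big_ord0 coef0 mul0rn.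
rewrite (bigD1 (Ordinal s0)) //= mulrnAr mulr1 big1 ?addr0 // => i.
by rewrite -val_eqE /= => /negPf->; rewrite mul0rn mulr0.
Qed.

(** * Sign patterns *)

(** The coefficients of p have the parity of n and alternate in sign, the
    coefficient of X^n being nonnegative.  The second exponent stands for
    (n - i) / 2: it has the same parity when n - i is even, and it avoids a
    truncated subtraction. *)
Definition tanh_sign (n : nat) (p : {poly rat}) : Prop := forall i,
  (odd i != odd n -> p`_i = 0) /\ 0 <= (-1) ^+ ((n + i)./2 + i) * p`_i.

Lemma tanh_sign1 : tanh_sign 0 1.
Proof.
move=> i; rewrite -[1]polyC1 coefC; case: i => [|i] /=; first by split.
by rewrite mulr0; split.
Qed.

(** All the operators needed send X^i to a nonnegative multiple of X^(i+1) minus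
    a nonnegative multiple of X^(i-1). *)
Lemma tanh_sign_step (a b : nat -> nat) n (p q : {poly rat}) :
  (forall i, q`_i = (if i is j.+1 then p`_j *+ a i else 0) - p`_i.+1 *+ b i) ->
  tanh_sign n p -> tanh_sign n.+1 q.
Proof.
move=> qE sgn_p i; rewrite qE; have [p0 pge] := sgn_p i.+1.
split=> [/= i_n|].
  rewrite p0 /= 1?(inj_eq negb_inj); last by move: i_n; do 2 case: odd.
  rewrite mul0rn subr0; case: i i_n {p0 pge qE} => //= j j_n.
  have [-> //] := sgn_p j; first by rewrite mul0rn.
  by move: j_n; do 2 case: odd.
have -> : (n.+1 + i)%N = (n + i.+1)%N by rewrite addSnnS.
rewrite mulrBr; apply: addr_ge0; last first.
  rewrite -mulNr mulrnAr mulrn_wge0 //.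
  by move: pge; rewrite addnS exprS mulN1r.
case: i {p0 pge qE} => [|j]; first by rewrite mulr0.
rewrite mulrnAr mulrn_wge0 //; have [_] := sgn_p j.
by rewrite !addnS /= addSn exprS exprS !mulN1r opprK.
Qed.

Lemma tanh_sign_sech n p : tanh_sign n p -> tanh_sign n.+1 (sech_deriv p).
Proof.
apply: (@tanh_sign_step id S) => i.
rewrite /sech_deriv mulrBl mul1r coefD coefB coefXM coefXnM !coef_deriv.
by case: i => [|[|i]] //=; rewrite ?add0r // subSS subn1 /= addrA -mulrS.
Qed.

Lemma tanh_sign_sech2 n p : tanh_sign n p -> tanh_sign n.+1 (sech2_deriv p).
Proof.
apply: (@tanh_sign_step S S) => i.
rewrite /sech2_deriv mulrBl mul1r coefD coefB mulrnAl coefMn coefXM coefXnM !coef_deriv.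
case: i => [|[|i]] //=; rewrite ?mul0rn ?add0r // subSS subn1 /=.
by rewrite addrA -mulrnDr.
Qed.

Lemma tanh_sign_mulX n p : tanh_sign n p -> tanh_sign n.+1 ('X * p).
Proof.
apply: (@tanh_sign_step (fun=> 1%N) (fun=> 0%N)) => i.
by rewrite coefXM subr0; case: i.
Qed.

Lemma tanh_sign_iter j n p :
  tanh_sign n p -> tanh_sign (j + n) (iter j sech_deriv p).
Proof. by move=> sgn_p; elim: j => //= j; apply: tanh_sign_sech. Qed.

Lemma tanh_sign_at0 n p : tanh_sign n p ->
  (odd n -> p.[0] = 0) /\ 0 <= (-1) ^+ n./2 * p.[0].
Proof.
by move/(_ 0%N); rewrite horner_coef0 !addn0 => -[p0 ?]; split=> // on; rewrite p0 ?on.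
Qed.

(** The function (d/dz + e)^k sech z is represented by (X + e) V^(k-1) 1.  The two
    summands X V^(k-1) 1 and V^(k-1) 1 have opposite parities, so that after j
    more derivatives only one of them is nonzero at 0. *)
Lemma sech_fun_shift_split j k : exists a b : rat,
  [/\ forall e : rat, e ^+ 2 = 1 ->
        sech_fun ('X^j * ('X + e%:P) ^+ k) = a + e * b,
      odd (j + k) -> a = 0,
      ~~ odd (j + k) -> b = 0 &
      0 <= (-1) ^+ (j + k)./2 * a].
Proof.
case: k => [|k].
  have [a0 a_ge0] := tanh_sign_at0 (tanh_sign_iter j tanh_sign1).
  exists (sech_num j), 0; split=> // e _.
  by rewrite expr0 mulr1 mulr0 addr0 sech_funXn.
pose v := iter k sech2_deriv 1.
have sgn_v : tanh_sign k v.
  by rewrite /v; elim: k {v} => [|k]; [apply: tanh_sign1 | apply: tanh_sign_sech2].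
have [a0 a_ge0] := tanh_sign_at0 (tanh_sign_iter j (tanh_sign_mulX sgn_v)).
have [b0 _] := tanh_sign_at0 (tanh_sign_iter j sgn_v).
exists (iter j sech_deriv ('X * v)).[0], (iter j sech_deriv v).[0].
split=> //; last by move=> ev; apply: b0; move: ev; rewrite addnS /= negbK.
move=> e e1; rewrite /sech_fun poly_actM act_shift_exp // -/v mulrDl mul_polyC.
rewrite poly_actXn -hornerZ -hornerD; congr horner.
by elim: (j) => //= i ->; rewrite linearD linearZ.
Qed.

Lemma sech_fun_sign j k : ~~ odd (j + k) ->
  0 <= (-1) ^+ (j + k)./2 * sech_fun ('X^j * ('X - 1) ^+ k).
Proof.
move=> ev; have [a [b [E _ /(_ ev) b0 a_ge0]]] := sech_fun_shift_split j k.
by rewrite -polyC1 -polyCN E // b0 mulr0 addr0.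
Qed.

(** The reflection X |-> -X preserves sech_fun because sech is even. *)
Lemma sech_fun_reflect j k :
  sech_fun ('X^j * ('X + 1) ^+ k) =
  (-1) ^+ (j + k) * sech_fun ('X^j * ('X - 1) ^+ k).
Proof.
have [a [b [E a0 b0 _]]] := sech_fun_shift_split j k.
rewrite -polyC1 -polyCN !E // -signr_odd.
by case: odd a0 b0 => [/(_ isT)-> _ | _ /(_ isT)->]; ring.
Qed.

(** * Weighted sums over chains *)

Section ChainSum.
Variables (T : finType) (le : rel T).
Hypotheses (le_refl : reflexive le) (le_anti : antisymmetric le).
Hypothesis le_trans : transitive le.

Definition chain_set (C : {set T}) : bool :=
  [forall x in C, forall y in C, le x y || le y x].

Lemma exists_maximal (S : {set T}) x0 : x0 \in S ->
  exists2 m, m \in S & forall x, x \in S -> le m x -> x = m.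
Proof.
move=> x0S; pose below x := #|[set y | le y x]|.
case: (arg_maxnP below x0S) => m mS max_m; exists m => // x xS mx.
have sub : [set y | le y m] \subset [set y | le y x].
  by apply/subsetP => y; rewrite !inE => /le_trans; apply.
have : x \in [set y | le y m].
  have /eqP <- : [set y | le y x] == [set y | le y m]; last by rewrite inE le_refl.
  by rewrite eq_sym eqEcard sub; exact: max_m.
by rewrite inE => xm; apply: le_anti; rewrite xm mx.
Qed.

Lemma chain_setU1 m (C : {set T}) : m \notin C -> (forall x, x \in C -> le m x -> x = m) ->
  chain_set (m |: C) = chain_set C && (C \subset [set y | (y != m) && le y m]).
Proof.
move=> mC max_m; apply/forall_inP/andP => [chC|[chC /subsetP subC] x].
  split.
    apply/forall_inP => x xC; apply/forall_inP => y yC.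
    by have /forall_inP := chC x (setU1r m xC); apply; apply: setU1r.
  apply/subsetP => x xC; rewrite inE; have xm : x != m by apply: contraNneq mC => <-.
  rewrite xm; have /forall_inP/(_ m (setU11 _ _)) := chC x (setU1r m xC).
  by case/orP => // /max_m -/(_ xC) xE; rewrite xE eqxx in xm.
move=> xmC; apply/forall_inP => y.
have below z : z \in C -> le z m by move/subC; rewrite inE => /andP[].
case/setU1P: xmC => [->|xC] /setU1P[->|yC]; rewrite ?le_refl ?below ?orbT //.
by have /forall_inP/(_ x xC)/forall_inP := chC; apply.
Qed.

(** Here w x is the total weight of the chains with largest element x.  The proof
    is an induction on down-closed sets S: for m maximal in S, a chain of S
    either avoids m or consists of m and a chain of elements below m. *)
Lemma sum_chains (R : comNzRingType) (t : R) (w : T -> R) :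
  (forall x, w x = t * (1 + \sum_(y | (y != x) && le y x) w y)) ->
  \sum_(C : {set T} | chain_set C) t ^+ #|C| = 1 + \sum_x w x.
Proof.
move=> wE.
suff main n (S : {set T}) : (#|S| <= n)%N ->
    (forall x y, x \in S -> le y x -> y \in S) ->
    \sum_(C : {set T} | chain_set C && (C \subset S)) t ^+ #|C| =
      1 + \sum_(x in S) w x.
  have := main _ [set: T] (leqnn _) (fun _ _ _ _ => in_setT _).
  under eq_bigl do rewrite subsetT andbT.
  by under [in RHS]eq_bigl do rewrite inE.
elim: n S => [|n IH] S card_S down_S.
  move: card_S; rewrite leqn0 cards_eq0 => /eqP->; rewrite big_set0 addr0.
  rewrite (big_pred1 set0) ?cards0 // => C; rewrite subset0 andbC /=.
  by case: eqP => //= ->; apply/forall_inP => x; rewrite in_set0.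
have [->|[x0 x0S]] := set_0Vmem S.
  by apply: IH => [|x y]; rewrite ?cards0 ?in_set0.
have [m mS max_m] := exists_maximal x0S.
have sumS : \sum_(x in S) w x = w m + \sum_(x in S :\ m) w x by rewrite (big_setD1 m).
have cardS : (#|S :\ m| <= n)%N.
  by rewrite -ltnS (leq_trans _ card_S) // [leqRHS](cardsD1 m) mS.
rewrite (bigID (fun C : {set T} => m \in C)) /= addrC.
have -> : \sum_(C : {set T} | chain_set C && (C \subset S) && (m \notin C)) t ^+ #|C|
          = 1 + \sum_(x in S :\ m) w x.
  rewrite -IH //; last first.
    move=> x y; rewrite !inE => /andP[xm xS] yx; rewrite (down_S x) // andbT.
    by apply: contraNneq xm => ym; rewrite (max_m x) // -ym.
  by apply: eq_bigl => C; rewrite subsetD1 andbA.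
pose L := [set y | (y != m) && le y m].
have subL : L \subset S :\ m.
  apply/subsetP => y; rewrite !inE => /andP[-> ym] /=; exact: down_S ym.
have -> : \sum_(C : {set T} | chain_set C && (C \subset S) && (m \in C)) t ^+ #|C| = w m.
  have -> : w m = t * (1 + \sum_(y in L) w y).
    by rewrite wE; congr (_ * (_ + _)); apply: eq_bigl => y; rewrite inE.
  rewrite -IH; first last.
  - move=> x y; rewrite !inE => /andP[xm x_le] yx; rewrite (le_trans yx) // andbT.
    by apply: contraNneq xm => ym; apply/eqP/le_anti; rewrite x_le -ym.
  - exact: leq_trans (subset_leq_card subL) cardS.
  rewrite big_distrr /=.
  rewrite (reindex_onto (fun C : {set T} => m |: C) (fun C => C :\ m)) /=; last first.
    by move=> C /andP[_ mC]; rewrite setD1K.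
  have keep (C : {set T}) : ((m |: C) :\ m == C) = (m \notin C).
    apply/eqP/idP => [<-|mC]; first by rewrite !inE eqxx.
    by rewrite setU1K.
  under eq_bigl => C do rewrite keep setU11 andbT.
  have predE (C : {set T}) : chain_set (m |: C) && (m |: C \subset S) && (m \notin C)
                = chain_set C && (C \subset L).
    have [mC|mC] /= := boolP (m \in C).
      rewrite andbF; apply/esym/negbTE; rewrite negb_and orbC.
      by apply/orP; left; apply/subsetPn; exists m; rewrite // !inE eqxx.
    rewrite andbT subUset sub1set mS /=.
    have [CS|CS] /= := boolP (C \subset S).
      rewrite andbT chain_setU1 // => x xC; apply: max_m.
      exact: (subsetP CS).
    rewrite andbF; apply/esym/negbTE; rewrite negb_and orbC.
    apply/orP; left; apply: contra CS => /subset_trans; apply.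
    by apply: subset_trans subL (subsetDl _ _).
  rewrite (eq_bigl _ _ predE); apply: eq_bigr => C /andP[_ CL].
  rewrite cardsU1 exprD -[X in _ ^+ X * _]/(nat_of_bool (m \notin C)).
  have -> : m \notin C; last by rewrite expr1.
  by apply: contraTN CL => mC; apply/subsetPn; exists m; rewrite // !inE eqxx.
by rewrite sumS; ring.
Qed.

End ChainSum.

(** * The h-vector and the faces *)

Lemma hnum_faces (T : finType) (K : simplicial_complex T) k :
  hnum K k = \sum_(F in faces K | (#|F| <= k)%N)
    (-1) ^+ (k - #|F|) * 'C(sc_rank K - #|F|, k - #|F|)%:R.
Proof.
rewrite [RHS](partition_big (fun F : {set T} => inord #|F| : 'I_k.+1) xpredT) //=.
apply: eq_bigr => i _.
have inE' (F : {set T}) : (F \in faces K) && (#|F| <= k)%N && (inord #|F| == i)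
                    = (F \in [set F in faces K | #|F| == i]).
  rewrite inE -andbA; case: (F \in faces K) => //=.
  have := ltn_ord i; rewrite ltnS => i_k.
  have [F_k|F_k] /= := leqP #|F| k; first by rewrite -val_eqE /= inordK.
  by apply/esym/gtn_eqF; apply: leq_ltn_trans F_k.
under eq_bigl do rewrite inE'.
rewrite (eq_bigr (fun=> (-1) ^+ (k - i) * 'C(sc_rank K - i, k - i)%:R)).
  by rewrite sumr_const -[RHS]mulr_natr.
by move=> F; rewrite inE => /andP[_ /eqP->].
Qed.

Lemma card_face_le (T : finType) (K : simplicial_complex T) F :
  F \in faces K -> (#|F| <= sc_rank K)%N.
Proof. exact: leq_bigmax_cond. Qed.

(** The homogenized h-polynomial.  A face F contributes to h_k the coefficient
    of a^(k-|F|) in the binomial expansion of (b - a)^(d-|F|). *)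
Lemma sum_hnum (T : finType) (K : simplicial_complex T) (R : comNzRingType)
    (a b : R) (d := sc_rank K) :
  \sum_(k < d.+1) (hnum K k)%:~R * a ^+ k * b ^+ (d - k) =
  \sum_(F in faces K) a ^+ #|F| * (b - a) ^+ (d - #|F|).
Proof.
under eq_bigr => k _.
  rewrite hnum_faces rmorph_sum /= !big_distrl /=.
  over.
rewrite (exchange_big_dep (mem (faces K))) /=; last by move=> i F _ /andP[].
apply: eq_bigr => F FK; have F_d := card_face_le FK; rewrite -/d in F_d *.
under eq_bigl do rewrite FK /=.
rewrite -(big_geq_mkord _ _ xpredT (fun k =>
  ((-1) ^+ (k - #|F|) * 'C(d - #|F|, k - #|F|)%:R)%:~R * a ^+ k * b ^+ (d - k))).
rewrite -{1}[#|F|]add0n big_addn subSn // big_mkord exprDn big_distrr /=.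
apply: eq_bigr => i _; rewrite addnK -subnDA [(#|F| + i)%N]addnC exprD.
rewrite [(- a) ^+ i]exprNn -[X in _ = _ * X]mulr_natr intrM intr_sign rmorph_nat.
move: (a ^+ i) (a ^+ #|F|) (b ^+ _) ((-1) ^+ i) (_%:R) => ai aF bk s c; ring.
Qed.

(** * Sums over intervals *)

(** Expand the product, over all elements i, of the weight of putting i in S plus
    the weight of leaving it out; weight 0 enforces the two inclusions. *)
Lemma sum_subsets_between (T : finType) (R : comNzRingType) (x y : R) (A B : {set T}) :
  A \subset B ->
  \sum_(S : {set T} | (A \subset S) && (S \subset B)) x ^+ #|S :\: A| * y ^+ #|B :\: S|
    = (x + y) ^+ #|B :\: A|.
Proof.
move=> /subsetP sAB.
pose f i : R := if i \in B then if i \in A then 1 else x else 0.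
pose g i : R := if i \in A then 0 else if i \in B then y else 1.
have -> : (x + y) ^+ #|B :\: A| = \prod_i (f i + g i).
  rewrite -prodr_const [LHS]big_mkcond; apply: eq_bigr => i _; rewrite !inE /f /g.
  case: (boolP (i \in A)) => [/sAB->|_] /=; first by rewrite addr0.
  by case: (i \in B); rewrite ?add0r.
rewrite bigA_distr [LHS]big_mkcond; apply: eq_bigr => S _.
have [/andP[/subsetP sAS /subsetP sSB]|] := boolP (_ && _).
  rewrite -!prodr_const !(big_mkcond (fun i => i \in _)) -big_split.
  apply: eq_bigr => i _; rewrite !inE /f /g.
  have [iS|iS] /= := boolP (i \in S); first by rewrite sSB // mulr1; case: (i \in A).
  by rewrite andbF mul1r (contraNF (@sAS i)).
rewrite negb_and => /orP[] /subsetPn[i iA iS]; rewrite (bigD1 i) //=.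
  by rewrite (negPf iS) /g iA mul0r.
by rewrite iA /f (negPf iS) mul0r.
Qed.

(** The intervals in [A, B] are the nonempty faces of a cube of dimension
    |B \ A|, counted by dimension. *)
Lemma sum_subintervals (T : finType) (R : comNzRingType) (x : R) (A B : {set T}) :
  A \subset B ->
  \sum_(p : {set T} * {set T} | [&& A \subset p.1, p.1 \subset p.2 & p.2 \subset B])
     x ^+ #|p.2 :\: p.1| = (x + 1 + 1) ^+ #|B :\: A|.
Proof.
move=> sAB; rewrite [x + 1 + 1]addrC -(sum_subsets_between 1 (x + 1)) //.
(* First choose the lower end S, with weight (x + 1)^|B \ S| for the upper ends. *)
under [RHS]eq_bigr => S SB.
  have /andP[sAS sSB] := SB.
  rewrite expr1n mul1r -(sum_subsets_between x 1) //.
  under eq_bigr do rewrite expr1n mulr1.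
  over.
rewrite pair_big_dep; apply: eq_bigl => p /=; rewrite -andbA; congr andb.
by apply/andP/and3P => [[s12 s2B]|[]]; rewrite ?(subset_trans s12).
Qed.

Section IntervalSums.
Variables (T : finType) (K : simplicial_complex T).
Notation intervals := (Defs.interval K).

Lemma sum_intervals (V : nmodType) (P : pred ({set T} * {set T}))
    (g : {set T} * {set T} -> V) :
  \sum_(I : intervals | P (val I)) g (val I) = \sum_(p | is_interval K p && P p) g p.
Proof.
rewrite (reindex_omap (val : intervals -> _) insub) /=; last first.
  by move=> p /andP[Kp _]; rewrite insubT.
by apply: eq_bigl => I; rewrite valK eqxx (valP I) andbT.
Qed.

Lemma interval_leE (I J : intervals) :
  interval_le J I = [&& (val I).1 \subset (val J).1, (val J).1 \subset (val J).2
                      & (val J).2 \subset (val I).2].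
Proof. by []. Qed.

Lemma interval_le_refl : reflexive (@interval_le _ K).
Proof. by move=> I; have /and3P[_ s _] := valP I; rewrite interval_leE !subxx s. Qed.

Lemma interval_le_anti : antisymmetric (@interval_le _ K).
Proof.
move=> I J; rewrite !interval_leE => /andP[/and3P[sJI _ sIJ] /and3P[sIJ' _ sJI']].
apply/val_inj; case: (val I) (val J) sJI sIJ sIJ' sJI' => [A B] [A' B'] /= *.
by congr pair; apply/eqP; rewrite eqEsubset; apply/andP.
Qed.

Lemma interval_le_trans : transitive (@interval_le _ K).
Proof.
move=> J I L; rewrite !interval_leE => /and3P[sJI sI sIJ] /and3P[sLJ _ sJL].
by rewrite sI (subset_trans sLJ) // (subset_trans sIJ).
Qed.

(** The total of (-1/2)^|C| over the chains C with largest interval p. *)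
Definition interval_weight (p : {set T} * {set T}) : rat :=
  - 2^-1 * sech_num #|p.2 :\: p.1|.

(** By sum_subintervals, summing sech_num over the faces of the m-cube gives
    sech_fun of (X + 2)^m, which sech_fun_shifts evaluates as 2 - sech_num m. *)
Lemma interval_weight_rec (I : intervals) :
  interval_weight (val I) =
  - 2^-1 * (1 + \sum_(J | (J != I) && interval_le J I) interval_weight (val J)).
Proof.
have /and3P[A0 sAB BK] := valP I.
set A := (val I).1 in A0 sAB; set B := (val I).2 in sAB BK.
pose sub (p : {set T} * {set T}) :=
  [&& A \subset p.1, p.1 \subset p.2 & p.2 \subset B].
have all_le : \sum_(J | interval_le J I) interval_weight (val J) =
    - 2^-1 * sech_fun (('X + 1 + 1) ^+ #|B :\: A|).
  rewrite -sum_subintervals // linear_sum mulr_sumr /=.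
  rewrite (sum_intervals sub interval_weight); apply: eq_big => [p|p _].
    apply: andb_idl => /and3P[sA s12 sB].
    rewrite /is_interval s12 (faces_down sB BK) !andbT.
    by apply: contraNneq A0 => p0; rewrite -subset0 -p0.
  by rewrite /= sech_funXn.
have := sech_fun_shifts (('X + 1) ^+ #|B :\: A|).
have sumE : \sum_(J | (J != I) && interval_le J I) interval_weight (val J) =
    \sum_(J | interval_le J I) interval_weight (val J) - interval_weight (val I).
  rewrite [in RHS](bigD1 I) ?interval_le_refl // addrC addKr.
  by apply: eq_bigl => J; rewrite andbC.
rewrite !rmorphXn !rmorphD /= !comp_polyX !rmorph1 subrK sech_funXn.
rewrite !hornerE expr1n sumE all_le /interval_weight -/A -/B => shifts; lra.
Qed.

(** For fixed B, the weights of the intervals [A, B] with A nonempty involve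
    (X + 1)^|B| - X^|B|; the shift X + 1 is then traded for X - 1 by means of
    sech_fun_shifts, where P takes the value 1 at 0 because of the empty face. *)
Lemma sum_interval_chains (P := \sum_(B in faces K) 'X^#|B| : {poly rat}) :
  \sum_(C in faces (interval_subdivision K)) (- 2^-1 : rat) ^+ #|C| =
  2^-1 * (sech_fun (P \Po ('X - 1)) + sech_fun P).
Proof.
under eq_bigl do rewrite inE.
rewrite (sum_chains interval_le_refl interval_le_anti interval_le_trans
  interval_weight_rec).
rewrite (sum_intervals xpredT).
have -> : \sum_(p | is_interval K p && true) interval_weight p =
    - 2^-1 * (sech_fun (P \Po ('X + 1)) - sech_fun P).
  transitivity (\sum_(B in faces K) \sum_(A | (A != set0) && (A \subset B))
     interval_weight (A, B)).
    rewrite (exchange_big_dep predT) //= pair_big_dep.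
    apply: eq_big => [[A B]|[A B] _] //=.
    by rewrite /is_interval /= andbT andbA andbC.
  rewrite !linear_sum /= -sumrB mulr_sumr; apply: eq_bigr => B _.
  have XB : ('X + 1) ^+ #|B| =
      'X^#|B| + \sum_(A | (A != set0) && (A \subset B)) 'X^#|B :\: A| :> {poly rat}.
    have := sum_subsets_between (1 : {poly rat}) 'X (sub0set B).
    rewrite setD0 [1 + 'X]addrC => <-; rewrite (bigD1 set0) ?sub0set //= setD0.
    rewrite expr1n mul1r setD0; congr (_ + _); apply: eq_big => [A|A _].
      by rewrite sub0set andbC.
    by rewrite expr1n mul1r.
  rewrite rmorphXn /= comp_polyX XB linearD /= addrC addKr.
  rewrite linear_sum mulr_sumr; apply: eq_bigr => A _.
  by rewrite /= sech_funXn.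
have P0 : P.[0] = 1.
  rewrite horner_sum (bigD1 set0) ?faces_set0 //= cards0 hornerXn expr0.
  rewrite big1 ?addr0 // => B /andP[_ B0]; rewrite hornerXn expr0n cards_eq0.
  by rewrite (negPf B0).
have := sech_fun_shifts P; rewrite P0 => shifts; lra.
Qed.

End IntervalSums.

(** * The sign of the h-polynomial at -1 *)

(** The exponent of 2 is the rank, so its value does not affect the sign. *)
Lemma hpoly_at_N1 (T : finType) (K : simplicial_complex T) :
  ((hpoly K).[-1])%:~R = 2 ^+ sc_rank K * \sum_(F in faces K) (- 2^-1) ^+ #|F| :> rat.
Proof.
rewrite horner_poly rmorph_sum /=.
transitivity (\sum_(k < (sc_rank K).+1)
    (hnum K k)%:~R * (-1) ^+ k * 1 ^+ (sc_rank K - k) : rat).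
  by apply: eq_bigr => k _; rewrite intrM intr_sign expr1n mulr1.
rewrite sum_hnum mulr_sumr; apply: eq_bigr => F FK; have F_d := card_face_le FK.
rewrite -[X in 2 ^+ X](subnK F_d) exprD -mulrA -exprMn opprK -[1 + 1]/2 mulrC.
by congr (_ * _ ^+ _).
Qed.

Lemma sum_face_monomials (T : finType) (K : simplicial_complex T) (R : comNzRingType)
    (d := sc_rank K) :
  \sum_(B in faces K) 'X^#|B| =
  \sum_(k < d.+1) (hnum K k)%:~R * ('X^k * ('X + 1) ^+ (d - k)) :> {poly R}.
Proof.
under [RHS]eq_bigr do rewrite mulrA.
rewrite sum_hnum; apply: eq_bigr => B _.
by rewrite addrC addKr expr1n mulr1.
Qed.

Theorem corollary4p11 (n d : nat) (Delta : simplicial_complex 'I_n)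
  (dim_Delta : sc_rank Delta = d)
  (h_ge0 : forall i : nat, (i <= d)%N -> 0 <= hnum Delta i)
  (h_sym : forall i : nat, (i <= d)%N -> hnum Delta i = hnum Delta (d - i)) :
  0 <= (-1) ^+ (d %/ 2) * (hpoly (interval_subdivision Delta)).[-1].
Proof.
rewrite -(ler0z rat) intrM intr_sign hpoly_at_N1 mulrCA.
rewrite mulr_ge0 ?exprn_ge0 // sum_interval_chains mulrCA mulr_ge0 //.
have intrE (m : int) : m%:~R = (m%:~R)%:P :> {poly rat} by rewrite rmorph_int.
pose q k := sech_fun ('X^k * ('X - 1) ^+ (d - k)).
have -> : sech_fun (\sum_(B in Delta) 'X^#|B|) =
    (-1) ^+ d * \sum_(k < d.+1) (hnum Delta k)%:~R * q k.
  rewrite sum_face_monomials dim_Delta linear_sum mulr_sumr; apply: eq_bigr => k _.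
  rewrite intrE mul_polyC linearZ /= sech_fun_reflect subnKC; last by rewrite -ltnS.
  by rewrite mulrCA.
have -> : sech_fun ((\sum_(B in Delta) 'X^#|B|) \Po ('X - 1)) =
    \sum_(k < d.+1) (hnum Delta k)%:~R * q k.
  (* Reversing the order of summation brings in the symmetry of the h-vector. *)
  rewrite sum_face_monomials dim_Delta !linear_sum (reindex_inj rev_ord_inj).
  apply: eq_bigr => k _; have k_d : (k <= d)%N by rewrite -ltnS.
  rewrite /= subSS -h_sym // subKn // intrE mul_polyC !linearZ /=.
  rewrite rmorphM !rmorphXn /= comp_polyX rmorphD /= comp_polyX !rmorph1 subrK.
  by rewrite /q ['X^k * _]mulrC.
rewrite -[X in X + _]mul1r -mulrDl -[(-1) ^+ d]signr_odd divn2.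
have [d_odd|d_even] := boolP (odd d); first by rewrite /= subrr mul0r mulr0.
rewrite mulrCA mulr_ge0 // mulr_sumr sumr_ge0 // => k _.
have k_d : (k <= d)%N by rewrite -ltnS.
rewrite mulrCA mulr_ge0 ?ler0z ?h_ge0 //.
by have := @sech_fun_sign k (d - k); rewrite subnKC //; apply.
Qed.
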